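(* Let $H:\mathfrak g\to\mathfrak h$ be a crossed homomorphism from a Lie-Yamaguti algebra $(\mathfrak g,[\cdot,\cdot]_{\mathfrak g},[\![\cdot,\cdot,\cdot]\!]_{\mathfrak g})$ to another Lie-Yamaguti algebra $(\mathfrak h,[\cdot,\cdot]_{\mathfrak h},[\![\cdot,\cdot,\cdot]\!]_{\mathfrak h})$ with respect to an action $(\rho,\mu)$. If two formal deformations $\bar H_t=\sum_{i=0}^\infty\bar{\mathfrak H}_it^i$ and $H_t=\sum_{i=0}^\infty\mathfrak H_it^i$ of $H$ are equivalent, then their infinitesimals $\bar{\mathfrak H}_1$ and $\mathfrak H_1$ are in the same cohomology class (in $\mathcal H^1_H(\mathfrak g,\mathfrak h)$).
   Context: All vector spaces are finite-dimensional over a field $\mathbb K$ of characteristic $0$. A Lie-Yamaguti algebra is a vector space $\mathfrak g$ with a bilinear bracket $[\cdot,\cdot]:\wedge^2\mathfrak g\to\mathfrak g$ and a trilinear bracket $[\![\cdot,\cdot,\cdot]\!]:\wedge^2\mathfrak g\otimes\mathfrak g\to\mathfrak g$ (skew-symmetric in the first two arguments) such that for all $x,y,z,w,t\in\mathfrak g$: (1) $[[x,y],z]+[[y,z],x]+[[z,x],y]+[\![x,y,z]\!]+[\![y,z,x]\!]+[\![z,x,y]\!]=0$; (2) $[\![[x,y],z,w]\!]+[\![[y,z],x,w]\!]+[\![[z,x],y,w]\!]=0$; (3) $[\![x,y,[z,w]]\!]=[[\![x,y,z]\!],w]+[z,[\![x,y,w]\!]]$; (4) $[\![x,y,[\![z,w,t]\!]]\!]=[\![[\![x,y,z]\!],w,t]\!]+[\![z,[\![x,y,w]\!],t]\!]+[\![z,w,[\![x,y,t]\!]]\!]$.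 A representation of $\mathfrak g$ on a vector space $V$ is a linear map $\rho:\mathfrak g\to\mathfrak{gl}(V)$ and a bilinear map $\mu:\otimes^2\mathfrak g\to\mathfrak{gl}(V)$ such that, with $D(x,y)=D_{\rho,\mu}(x,y):=\mu(y,x)-\mu(x,y)+[\rho(x),\rho(y)]-\rho([x,y])$, for all $x,y,z,w\in\mathfrak g$: $\mu([x,y],z)-\mu(x,z)\rho(y)+\mu(y,z)\rho(x)=0$; $\mu(x,[y,z])-\rho(y)\mu(x,z)+\rho(z)\mu(x,y)=0$; $\rho([\![x,y,z]\!])=[D(x,y),\rho(z)]$; $\mu(z,w)\mu(x,y)-\mu(y,w)\mu(x,z)-\mu(x,[\![y,z,w]\!])+D(y,z)\mu(x,w)=0$; $\mu([\![x,y,z]\!],w)+\mu(z,[\![x,y,w]\!])=[D(x,y),\mu(z,w)]$. The center of $\mathfrak h$ is $C(\mathfrak h):=\{u:[u,v]=0\ \forall v\}\cap\big(\{u:[\![u,v,w]\!]=0\ \forall v,w\}\cup\{u:[\![v,u,w]\!]=0\ \forall v,w\}\big)$. An action of $\mathfrak g$ on $\mathfrak h$ is a representation $(\rho,\mu)$ of $\mathfrak g$ on the vector space $\mathfrak h$ such that for all $x,y\in\mathfrak g$, $u,v,w\in\mathfrak h$: $\rho(x)u,\ \mu(x,y)u\in C(\mathfrak h)$; $\rho(x)[u,v]_{\mathfrak h}=\mu(x,y)[u,v]_{\mathfrak h}=0$; $\rho(x)[\![u,v,w]\!]_{\mathfrak h}=\mu(x,y)[\![u,v,w]\!]_{\mathfrak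 h}=0$. A crossed homomorphism from $\mathfrak g$ to $\mathfrak h$ with respect to $(\rho,\mu)$ is a linear map $H:\mathfrak g\to\mathfrak h$ such that for all $x,y,z\in\mathfrak g$: $H[x,y]_{\mathfrak g}=\rho(x)H(y)-\rho(y)H(x)+[Hx,Hy]_{\mathfrak h}$ and $H[\![x,y,z]\!]_{\mathfrak g}=D(x,y)H(z)+\mu(y,z)H(x)-\mu(x,z)H(y)+[\![Hx,Hy,Hz]\!]_{\mathfrak h}$. Formal deformations: the brackets of $\mathfrak g,\mathfrak h$ and the maps $\rho,\mu,D$ are extended $\mathbb K[[t]]$-multilinearly (coefficientwise) to $\mathfrak g[[t]]$, $\mathfrak h[[t]]$. A formal deformation of $H$ is a power series $H_t=\sum_{i\ge0}\mathfrak H_it^i$ with $\mathfrak H_i\in\mathrm{Hom}(\mathfrak g,\mathfrak h)$, $\mathfrak H_0=H$, such that for all $x,y,z\in\mathfrak g$: $H_t[x,y]_{\mathfrak g}=\rho(x)(H_ty)-\rho(y)(H_tx)+[H_tx,H_ty]_{\mathfrak h}$ and $H_t[\![x,y,z]\!]_{\mathfrak g}=D(x,y)(H_tz)+\mu(y,z)(H_tx)-\mu(x,z)(H_ty)+[\![H_tx,H_ty,H_tz]\!]_{\mathfrak h}$. Its infinitesimal is $\mathfrak H_1$ (it is a $1$-cocycle). For $\mathfrak X\in\wedge^2\mathfrak g$, $\mathfrak L(\mathfrak X)\in\mathfrak{gl}(\mathfrak g)$ and $D(\mathfrak X)\in\mathfrak{gl}(\mathfrak h)$ are the linear extensions of $\mathfrak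 L(x\wedge y)z=[\![x,y,z]\!]_{\mathfrak g}$ and $D(x\wedge y)=D(x,y)$. Two formal deformations $\bar H_t$ and $H_t$ of $H$ are equivalent if there exist $\mathfrak X\in\wedge^2\mathfrak g$, $\phi_i\in\mathfrak{gl}(\mathfrak g)$, $\varphi_i\in\mathfrak{gl}(\mathfrak h)$, $i\geq2$, such that for $\phi_t=\mathrm{Id}_{\mathfrak g}+t\mathfrak L(\mathfrak X)+\sum_{i\ge2}\phi_it^i$ and $\varphi_t=\mathrm{Id}_{\mathfrak h}+tD(\mathfrak X)+\sum_{i\ge2}\varphi_it^i$: for all $x,y,z\in\mathfrak g$, $u,v,w\in\mathfrak h$, $[\phi_t(x),\phi_t(y)]_{\mathfrak g}=\phi_t[x,y]_{\mathfrak g}$, $[\![\phi_t(x),\phi_t(y),\phi_t(z)]\!]_{\mathfrak g}=\phi_t[\![x,y,z]\!]_{\mathfrak g}$; $[\varphi_t(u),\varphi_t(v)]_{\mathfrak h}=\varphi_t[u,v]_{\mathfrak h}$, $[\![\varphi_t(u),\varphi_t(v),\varphi_t(w)]\!]_{\mathfrak h}=\varphi_t[\![u,v,w]\!]_{\mathfrak h}$; $\varphi_t\rho(x)u=\rho(\phi_t(x))(\varphi_t(u))$, $\varphi_t\mu(x,y)u=\mu(\phi_t(x),\phi_t(y))(\varphi_t(u))$; and $H_t\circ\phi_t=\varphi_t\circ\bar H_t$ as $\mathbb K[[t]]$-module maps. First cohomology group of $H$: let $\rho_H(x)u=[Hx,u]_{\mathfrak h}+\rho(x)u$, $\mu_H(x,y)u=[\![u,Hx,Hy]\!]_{\mathfrak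 h}+\mu(x,y)u$, $D_H(x,y)u=[\![Hx,Hy,u]\!]_{\mathfrak h}+D(x,y)u$. The $1$-cocycles $\mathcal Z^1_H(\mathfrak g,\mathfrak h)$ are the $f\in\mathrm{Hom}(\mathfrak g,\mathfrak h)$ with $\rho_H(x)f(y)-\rho_H(y)f(x)-f([x,y]_{\mathfrak g})=0$ and $D_H(x,y)f(z)+\mu_H(y,z)f(x)-\mu_H(x,z)f(y)-f([\![x,y,z]\!]_{\mathfrak g})=0$ for all $x,y,z\in\mathfrak g$. The $1$-coboundaries $\mathcal B^1_H(\mathfrak g,\mathfrak h)$ are the maps $\partial(\mathfrak X)$, $\mathfrak X\in\wedge^2\mathfrak g$, where $\partial:\wedge^2\mathfrak g\to\mathrm{Hom}(\mathfrak g,\mathfrak h)$ is the linear map with $\partial(x\wedge y)(z)=\mu(y,z)(Hx)-\mu(x,z)(Hy)+[\![Hx,Hy,Hz]\!]_{\mathfrak h}$. Then $\mathcal H^1_H(\mathfrak g,\mathfrak h)=\mathcal Z^1_H(\mathfrak g,\mathfrak h)/\mathcal B^1_H(\mathfrak g,\mathfrak h)$. *)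

(* Defs.v *)
From HB Require Import structures.
From mathcomp Require Import all_boot all_order all_algebra ring.

Set Implicit Arguments.
Unset Strict Implicit.
Unset Printing Implicit Defensive.

Import GRing.Theory.
Local Open Scope ring_scope.

Lemma linfunE_linear (K : fieldType) (U V : vectType K) (f : U -> V) :
  linear f -> linfun f =1 f.
Proof.
move=> fL x.
pose F : {linear U -> V} := HB.pack f (GRing.isLinear.Build K U V *:%R f fL).
exact: (lfunE F x).
Qed.

Section LinearSimp.
Variables (K : fieldType) (U V : vectType K).
Implicit Types F G : 'Hom(U, V).

Lemma homD F x y : F (x + y) = F x + F y. Proof. exact: linearD. Qed.
Lemma homN F x : F (- x) = - F x. Proof. exact: linearN. Qed.
Lemma homZ F a x : F (a *: x) = a *: F x. Proof. exact: linearZ. Qed.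
Lemma hom0 F : F 0 = 0. Proof. exact: linear0. Qed.
Lemma homP F a x y : F (a *: x + y) = a *: F x + F y.
Proof. exact: linearP. Qed.
Lemma homB F x y : F (x - y) = F x - F y. Proof. exact: linearB. Qed.
Lemma homPl a F G x : (a *: F + G) x = a *: F x + G x.
Proof. by rewrite add_lfunE scale_lfunE. Qed.
End LinearSimp.

Definition hom_simp := (homD, zero_lfunE, add_lfunE).

Section CoordSimp.
Variables (K : fieldType) (V : vectType K).
Local Notation c := (coord (vbasis {:V})).

Lemma coordD i x y : c i (x + y) = c i x + c i y. Proof. exact: linearD. Qed.
Lemma coordN i x : c i (- x) = - c i x. Proof. exact: linearN. Qed.
Lemma coordZ i a x : c i (a *: x) = a * c i x. Proof. exact: linearZ. Qed.
Lemma coord_0 i : c i 0 = 0. Proof. exact: linear0. Qed.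

Lemma coord_eq x y : (forall i, c i x = c i y) -> x = y.
Proof.
move=> xy; rewrite (coord_vbasis (memvf x)) (coord_vbasis (memvf y)).
by apply: eq_bigr => i _; rewrite xy.
Qed.

End CoordSimp.

Ltac hom_expand :=
  repeat progress
    rewrite ?comp_lfunE ?add_lfunE ?opp_lfunE ?scale_lfunE ?homD ?homZ ?homN.

(* Proves identities between linear combinations of the same vectors. *)
Ltac combine :=
  apply: coord_eq => ?;
  rewrite ?coordD ?coordN; repeat progress rewrite ?coordZ ?coordD ?coordN;
  rewrite ?coord_0; ring.

Ltac module := hom_expand; combine.

(* The exterior square of V, as the space of matrices spanned by the
   antisymmetrised tensors x (x) y - y (x) x, written in the coordinates of a
   fixed basis of V. The lemmas [ext2_lift_wedge] and [ext2_eq] are its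
   universal property. *)
Section ExteriorSquare.
Variables (K : fieldType) (V : vectType K).

Definition ebasis (i : 'I_(\dim {:V})) : V := (vbasis {:V})`_i.

Definition wedge_mx (x y : V) : 'M[K]_(\dim {:V}) :=
  \matrix_(i, j) (coord (vbasis {:V}) i x * coord (vbasis {:V}) j y
                  - coord (vbasis {:V}) j x * coord (vbasis {:V}) i y).

Definition ext2_gen : seq 'M[K]_(\dim {:V}) :=
  [seq wedge_mx (ebasis p.1) (ebasis p.2) |
   p : 'I_(\dim {:V}) * 'I_(\dim {:V})].

Definition ext2_space : {vspace 'M[K]_(\dim {:V})} := <<ext2_gen>>%VS.

Definition ext2 : vectType K := subvs_of ext2_space.

Definition wedge (x y : V) : ext2 := vsproj ext2_space (wedge_mx x y).

Definition ext2_lift (W : vectType K) (f : V -> V -> W) : 'Hom(ext2, W) :=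
  linfun (fun X : ext2 =>
    \sum_(i < \dim {:V}) \sum_(j < \dim {:V} | (i < j)%N)
      vsval X i j *: f (ebasis i) (ebasis j)).

Lemma ebasisE (x : V) : x = \sum_i coord (vbasis {:V}) i x *: ebasis i.
Proof. exact: (coord_vbasis (memvf x)). Qed.

Lemma wedge_mxE (x y : V) :
  wedge_mx x y = \sum_i \sum_j
    (coord (vbasis {:V}) i x * coord (vbasis {:V}) j y) *:
      wedge_mx (ebasis i) (ebasis j).
Proof.
have cE i k : coord (vbasis {:V}) i (ebasis k) = (k == i)%:R.
  by rewrite /ebasis coord_free ?(basis_free (vbasisP _)).
apply/matrixP=> a b; rewrite !mxE summxE.
under eq_bigr => i _.
  rewrite summxE.
  under eq_bigr => j _ do rewrite !mxE !cE mulrBr.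
  rewrite big_split /= sumrN.
  rewrite (bigD1 b) //= eqxx mulr1 big1 ?addr0; last first.
    by move=> j /negPf->; rewrite !mulr0.
  rewrite (bigD1 a) //= eqxx mulr1 big1 ?addr0; last first.
    by move=> j /negPf->; rewrite !mulr0.
  over.
rewrite big_split /= sumrN; congr (_ - _).
- by rewrite (bigD1 a) //= eqxx mulr1 big1 ?addr0 // => i /negPf->; rewrite mulr0.
- by rewrite (bigD1 b) //= eqxx mulr1 big1 ?addr0 // => i /negPf->; rewrite mulr0.
Qed.

Lemma wedge_mx_mem (x y : V) : wedge_mx x y \in ext2_space.
Proof.
rewrite wedge_mxE; apply: memv_suml => i _; apply: memv_suml => j _.
apply/memvZ/memv_span/mapP.
by exists (i, j); rewrite // mem_enum.
Qed.

Lemma vsval_wedge (x y : V) : vsval (wedge x y) = wedge_mx x y.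
Proof. by rewrite /wedge vsprojK // wedge_mx_mem. Qed.

Lemma wedge_linearl (y : V) : linear (wedge^~ y).
Proof.
move=> a x x'; apply: val_inj; rewrite /= !vsval_wedge.
by apply/matrixP=> i j; rewrite !mxE !linearP /= /GRing.scale /=; ring.
Qed.

Lemma wedge_alt (x : V) : wedge x x = 0.
Proof.
apply: val_inj; rewrite /= vsval_wedge.
by apply/matrixP=> i j; rewrite !mxE mulrC subrr.
Qed.

Lemma wedge_skew (x y : V) : wedge x y = - wedge y x.
Proof.
apply: val_inj; rewrite /= !vsval_wedge.
by apply/matrixP=> i j; rewrite !mxE opprB mulrC [X in _ - X]mulrC.
Qed.

Lemma ext2_liftE (W : vectType K) (f : V -> V -> W) (X : ext2) :
  ext2_lift f X = \sum_(i < \dim {:V}) \sum_(j < \dim {:V} | (i < j)%N)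
                    vsval X i j *: f (ebasis i) (ebasis j).
Proof.
rewrite linfunE_linear // => a Y Z.
rewrite scaler_sumr -big_split; apply: eq_bigr => i _ /=.
rewrite scaler_sumr -big_split; apply: eq_bigr => j _ /=.
by rewrite !mxE scalerDl scalerA.
Qed.

Lemma ext2_lift_wedge (W : vectType K) (f : V -> V -> W)
    (fl : forall y, linear (f^~ y)) (fr : forall x, linear (f x))
    (falt : forall x, f x x = 0) (x y : V) :
  ext2_lift f (wedge x y) = f x y.
Proof.
have fC u v : f u v = - f v u.
  have fD p q r : f (p + q) r = f p r + f q r.
    by have := fl r 1 p q; rewrite /= !scale1r.
  have fD' p q r : f p (q + r) = f p q + f p r.
    by have := fr p 1 q r; rewrite /= !scale1r.
  have := falt (u + v); rewrite fD !fD' !falt add0r addr0.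
  by move/eqP; rewrite addr_eq0 => /eqP.
have fE : f x y = \sum_i \sum_j
    (coord (vbasis {:V}) i x * coord (vbasis {:V}) j y) *:
      f (ebasis i) (ebasis j).
  pose Fl v : {linear V -> W} :=
    HB.pack (f^~ v) (GRing.isLinear.Build K V W *:%R (f^~ v) (fl v)).
  pose Fr v : {linear V -> W} :=
    HB.pack (f v) (GRing.isLinear.Build K V W *:%R (f v) (fr v)).
  rewrite {1}(ebasisE x) -[LHS]/(Fl y _) linear_sum; apply: eq_bigr => i _.
  rewrite linearZ /= {1}(ebasisE y) -[f _ _]/(Fr _ _) linear_sum scaler_sumr.
  by apply: eq_bigr => j _; rewrite linearZ /= scalerA.
rewrite ext2_liftE vsval_wedge fE.
set cx := fun i => coord (vbasis {:V}) i x.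
set cy := fun i => coord (vbasis {:V}) i y.
set n := \dim _ in cx cy *.
pose g i j := (cx i * cy j) *: f (ebasis i) (ebasis j).
transitivity (\sum_(i < n) \sum_(j < n | (i < j)%N) g i j
            + \sum_(i < n) \sum_(j < n | (i < j)%N) g j i).
  rewrite -big_split; apply: eq_bigr => i _ /=.
  rewrite -big_split; apply: eq_bigr => j _ /=.
  rewrite mxE scalerBl /g; congr (_ + _).
  by rewrite (fC (ebasis j)) scalerN.
rewrite [X in _ + X](exchange_big_dep xpredT) //= -big_split.
apply: eq_bigr => i _ /=.
rewrite [RHS](bigID (fun j : 'I_n => (i < j)%N)) /=; congr (_ + _).
rewrite [RHS](bigD1 i) /=; last by rewrite ltnn.
rewrite falt scaler0 add0r; apply: eq_bigl => j.
by rewrite -leqNgt ltn_neqAle andbC.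
Qed.

Lemma ext2_eq (W : vectType K) (F G : 'Hom(ext2, W)) :
  (forall x y, F (wedge x y) = G (wedge x y)) -> F = G.
Proof.
move=> FG; apply/lfunP=> X.
have XE : vsval X = \sum_i coord (in_tuple ext2_gen) i (vsval X) *: ext2_gen`_i.
  by apply: (@coord_span _ _ _ (in_tuple ext2_gen)); exact: (valP X).
have -> : X = \sum_i coord (in_tuple ext2_gen) i (vsval X) *:
    vsproj ext2_space ext2_gen`_i.
  apply: val_inj; rewrite /= {1}XE linear_sum; apply: eq_bigr => i _.
  by rewrite linearZ /= vsprojK // memv_span // mem_nth.
rewrite !linear_sum; apply: eq_bigr => i _; rewrite !linearZ /=; congr (_ *: _).
have /mapP[p _ ->] : ext2_gen`_i \in ext2_gen by apply: mem_nth.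
exact: FG.
Qed.

End ExteriorSquare.

(* Multilinear maps are iterated linear maps. *)
Record lieYamaguti (K : fieldType) := LieYamaguti {
  ly_carrier :> vectType K;
  ly_br : 'Hom(ly_carrier, 'End(ly_carrier));
  ly_tr : 'Hom(ly_carrier, 'Hom(ly_carrier, 'End(ly_carrier)));
  ly_br_alt : forall x, ly_br x x = 0;
  ly_tr_alt : forall x y, ly_tr x x y = 0;
  ly_jacobi : forall x y z,
    ly_br (ly_br x y) z + ly_br (ly_br y z) x + ly_br (ly_br z x) y
      + ly_tr x y z + ly_tr y z x + ly_tr z x y = 0;
  ly_tr_br_cyclic : forall x y z w,
    ly_tr (ly_br x y) z w + ly_tr (ly_br y z) x w + ly_tr (ly_br z x) y w = 0;
  ly_tr_br : forall x y z w,
    ly_tr x y (ly_br z w) = ly_br (ly_tr x y z) w + ly_br z (ly_tr x y w);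
  ly_tr_tr : forall x y z w t,
    ly_tr x y (ly_tr z w t) =
      ly_tr (ly_tr x y z) w t + ly_tr z (ly_tr x y w) t
      + ly_tr z w (ly_tr x y t)
}.

Notation "[ 'ly' x , y ]" := (ly_br _ x y)
  (at level 0, x at level 99, y at level 99, format "[ 'ly'  x ,  y ]").
Notation "[ 'ly' x , y , z ]" := (ly_tr _ x y z)
  (at level 0, x at level 99, y at level 99, z at level 99,
   format "[ 'ly'  x ,  y ,  z ]").

Section LieYamagutiTheory.
Variables (K : fieldType) (g : lieYamaguti K).

Lemma ly_br_skew (x y : g) : [ly x, y] = - [ly y, x].
Proof.
have := ly_br_alt (x + y); rewrite !hom_simp !ly_br_alt.
by rewrite add0r addr0 => /eqP; rewrite addrC addr_eq0 => /eqP.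
Qed.

Lemma ly_tr_skew (x y z : g) : [ly x, y, z] = - [ly y, x, z].
Proof.
have := ly_tr_alt (x + y) z; rewrite !hom_simp !ly_tr_alt.
by rewrite add0r addr0 => /eqP; rewrite addrC addr_eq0 => /eqP.
Qed.

End LieYamagutiTheory.

Definition gl_comm (K : fieldType) (V : vectType K) (f g : 'End(V)) : 'End(V) :=
  (f \o g)%VF - (g \o f)%VF.

Definition repD (K : fieldType) (g : lieYamaguti K) (V : vectType K)
    (rho : 'Hom(g, 'End(V))) (mu : 'Hom(g, 'Hom(g, 'End(V)))) (x y : g)
    : 'End(V) :=
  mu y x - mu x y + gl_comm (rho x) (rho y) - rho [ly x, y].

Record is_representation (K : fieldType) (g : lieYamaguti K) (V : vectType K)
    (rho : 'Hom(g, 'End(V))) (mu : 'Hom(g, 'Hom(g, 'End(V)))) : Prop := {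
  rep_mu_brl : forall x y z,
    mu [ly x, y] z - (mu x z \o rho y)%VF + (mu y z \o rho x)%VF = 0;
  rep_mu_brr : forall x y z,
    mu x [ly y, z] - (rho y \o mu x z)%VF + (rho z \o mu x y)%VF = 0;
  rep_rho_tr : forall x y z,
    rho [ly x, y, z] = gl_comm (repD rho mu x y) (rho z);
  rep_mu_mu : forall x y z w,
    (mu z w \o mu x y)%VF - (mu y w \o mu x z)%VF - mu x [ly y, z, w]
      + (repD rho mu y z \o mu x w)%VF = 0;
  rep_mu_tr : forall x y z w,
    mu [ly x, y, z] w + mu z [ly x, y, w] = gl_comm (repD rho mu x y) (mu z w)
}.

Definition in_center (K : fieldType) (h : lieYamaguti K) (u : h) : Prop :=
  (forall v, [ly u, v] = 0) /\
  ((forall v w, [ly u, v, w] = 0) \/ (forall v w, [ly v, u, w] = 0)).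

Record is_action (K : fieldType) (g h : lieYamaguti K)
    (rho : 'Hom(g, 'End(h))) (mu : 'Hom(g, 'Hom(g, 'End(h)))) : Prop := {
  act_rep : is_representation rho mu;
  act_rho_center : forall x u, in_center (rho x u);
  act_mu_center : forall x y u, in_center (mu x y u);
  act_rho_br : forall x u v, rho x [ly u, v] = 0;
  act_mu_br : forall x y u v, mu x y [ly u, v] = 0;
  act_rho_tr : forall x u v w, rho x [ly u, v, w] = 0;
  act_mu_tr : forall x y u v w, mu x y [ly u, v, w] = 0
}.

Section CrossedHomomorphism.
Variables (K : fieldType) (g h : lieYamaguti K).
Variables (rho : 'Hom(g, 'End(h))) (mu : 'Hom(g, 'Hom(g, 'End(h)))).
Local Notation D := (repD rho mu).

Record is_crossed_hom (H : 'Hom(g, h)) : Prop := {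
  crossed_br : forall x y : g,
    H [ly x, y] = rho x (H y) - rho y (H x) + [ly H x, H y];
  crossed_tr : forall x y z : g,
    H [ly x, y, z] =
      D x y (H z) + mu y z (H x) - mu x z (H y) + [ly H x, H y, H z]
}.

Definition extL : 'Hom(ext2 g, 'End(g)) := ext2_lift (fun x y : g => ly_tr g x y).

Definition extD : 'Hom(ext2 g, 'End(h)) := ext2_lift D.

Lemma extL_wedge x y : extL (wedge x y) = ly_tr g x y.
Proof.
apply: ext2_lift_wedge => [v a u u'|u a v v'|u].
- by rewrite linearP !lfun_simp.
- by rewrite linearP.
- by apply/lfunP => z; rewrite ly_tr_alt lfun_simp.
Qed.

Lemma repD_skew x y : D x y = - D y x.
Proof.
by apply/lfunP => u; rewrite /repD /gl_comm (ly_br_skew x y); module.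
Qed.

Lemma repDE x y u :
  D x y u = mu y x u - mu x y u + (rho x (rho y u) - rho y (rho x u))
            - rho [ly x, y] u.
Proof. by rewrite /repD /gl_comm !(add_lfunE, opp_lfunE, comp_lfunE). Qed.

Lemma repD_linearl y : linear (D^~ y).
Proof.
move=> a x x'; apply/lfunP => u.
by rewrite homPl !repDE !homP !homPl !homP !homPl; combine.
Qed.

Lemma repD_alt x : D x x = 0.
Proof. by rewrite /repD /gl_comm ly_br_alt hom0 !subrr subr0 addr0. Qed.

Lemma extD_wedge x y : extD (wedge x y) = D x y.
Proof.
apply: ext2_lift_wedge; [exact: repD_linearl | | exact: repD_alt].
move=> u a v w; rewrite (repD_skew u) (repD_skew u v) (repD_skew u w).
by rewrite (repD_linearl u a v w) opprD scalerN.
Qed.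

Section Cohomology.
Variable H : 'Hom(g, h).

Definition rhoH (x : g) (u : h) : h := [ly H x, u] + rho x u.
Definition muH (x y : g) (u : h) : h := [ly u, H x, H y] + mu x y u.
Definition DH (x y : g) (u : h) : h := [ly H x, H y, u] + D x y u.

Definition cobr (f : 'Hom(g, h)) (x y : g) : h :=
  rhoH x (f y) - rhoH y (f x) - f [ly x, y].

Definition cotr (f : 'Hom(g, h)) (x y z : g) : h :=
  DH x y (f z) + muH y z (f x) - muH x z (f y) - f [ly x, y, z].

Definition cobr_lfun : 'Hom('Hom(g, h), 'Hom(g, 'Hom(g, h))) :=
  linfun (fun f => linfun (fun x => linfun (cobr f x))).

Definition cotr_lfun : 'Hom('Hom(g, h), 'Hom(g, 'Hom(g, 'Hom(g, h)))) :=
  linfun (fun f => linfun (fun x => linfun (fun y => linfun (cotr f x y)))).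

Definition Z1 : {vspace 'Hom(g, h)} := (lker cobr_lfun :&: lker cotr_lfun)%VS.

Definition wedge_cobound (x y : g) : 'Hom(g, h) :=
  linfun (fun z => mu y z (H x) - mu x z (H y) + [ly H x, H y, H z]).

Definition cobound : 'Hom(ext2 g, 'Hom(g, h)) := ext2_lift wedge_cobound.

Definition B1 : {vspace 'Hom(g, h)} := limg cobound.

(* B1 inside Z1 (see [B1_sub_Z1]). *)
Definition B1Z : {vspace subvs_of Z1} := (linfun (@vsval _ _ Z1) @^-1: B1)%VS.

(* The first cohomology group Z1 / B1. *)
Definition H1 := Quotient.quot (pred_of_vspace B1Z : zmodClosed (subvs_of Z1)).

Definition cohom_class (f : subvs_of Z1) : H1 := \pi_H1%qT f.

Lemma rhoH_l y : linear (rhoH^~ y).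
Proof. by move=> a x x'; rewrite /rhoH !homP !homPl; combine. Qed.

Lemma rhoH_r x : linear (rhoH x).
Proof. by move=> a u v; rewrite /rhoH !homP; combine. Qed.

Lemma muH_l y u : linear (fun x => muH x y u).
Proof. by move=> a x x'; rewrite /muH !homP !homPl; combine. Qed.

Lemma muH_m x u : linear (fun y => muH x y u).
Proof. by move=> a y y'; rewrite /muH !homP homPl; combine. Qed.

Lemma muH_r x y : linear (muH x y).
Proof. by move=> a u v; rewrite /muH !homP !homPl; combine. Qed.

Lemma DH_l y u : linear (fun x => DH x y u).
Proof. by move=> a x x'; rewrite /DH repD_linearl !homP !homPl; combine. Qed.

Lemma DH_skew x y u : DH x y u = - DH y x u.
Proof. by rewrite /DH repD_skew ly_tr_skew opp_lfunE opprD. Qed.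

Lemma DH_m x u : linear (fun y => DH x y u).
Proof.
by move=> a y y'; rewrite !(DH_skew x) (DH_l x u a y y') opprD scalerN.
Qed.

Lemma DH_r x y : linear (DH x y).
Proof. by move=> a u v; rewrite /DH !homP; combine. Qed.

Lemma cobr_lfunE f x y : cobr_lfun f x y = cobr f x y.
Proof.
have L3 f' x' : linear (cobr f' x').
  by move=> a y1 y2; rewrite /cobr !homP rhoH_r rhoH_l; combine.
have L2 f' : linear (fun x => linfun (cobr f' x)).
  move=> a x1 x2; apply/lfunP => y'; rewrite homPl !linfunE_linear //.
  by rewrite /cobr !homP homPl homP rhoH_r rhoH_l; combine.
have L1 : linear (fun f => linfun (fun x => linfun (cobr f x))).
  move=> a f1 f2; apply/lfunP => x'; apply/lfunP => y'.
  rewrite homPl ![linfun _ x']linfunE_linear // homPl.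
  rewrite !linfunE_linear //.
  by rewrite /cobr !homPl !rhoH_r; combine.
by rewrite /cobr_lfun !linfunE_linear.
Qed.

Lemma cotr_lfunE f x y z : cotr_lfun f x y z = cotr f x y z.
Proof.
have L4 f' x' y' : linear (cotr f' x' y').
  by move=> a z1 z2; rewrite /cotr !homP DH_r !muH_m; combine.
have L3 f' x' : linear (fun y => linfun (cotr f' x' y)).
  move=> a y1 y2; apply/lfunP => z'; rewrite homPl !linfunE_linear //.
  by rewrite /cotr !homP homPl homP DH_m muH_l muH_r; combine.
have L2 f' : linear (fun x => linfun (fun y => linfun (cotr f' x y))).
  move=> a x1 x2; apply/lfunP => y'; apply/lfunP => z'.
  rewrite homPl ![linfun _ y']linfunE_linear // homPl.
  rewrite !linfunE_linear //.
  by rewrite /cotr !homP !homPl homP DH_l muH_l muH_r; combine.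
have L1 : linear (fun f => linfun (fun x => linfun (fun y => linfun (cotr f x y)))).
  move=> a f1 f2; apply/lfunP => x'; apply/lfunP => y'; apply/lfunP => z'.
  rewrite homPl ![linfun _ x']linfunE_linear // homPl.
  rewrite ![linfun _ y']linfunE_linear // homPl.
  rewrite !linfunE_linear //.
  by rewrite /cotr !homPl DH_r !muH_r; combine.
by rewrite /cotr_lfun !linfunE_linear.
Qed.

Lemma Z1P f :
  reflect ((forall x y, cobr f x y = 0) /\ (forall x y z, cotr f x y z = 0))
          (f \in Z1).
Proof.
rewrite memv_cap !memv_ker.
apply: (iffP andP) => -[].
  move=> /eqP f1 /eqP f2; split=> [x y|x y z].
    by rewrite -cobr_lfunE f1 !zero_lfunE.
  by rewrite -cotr_lfunE f2 !zero_lfunE.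
move=> f1 f2; split; apply/eqP/lfunP => x; apply/lfunP => y.
  by rewrite cobr_lfunE f1 !zero_lfunE.
by apply/lfunP => z; rewrite cotr_lfunE f2 !zero_lfunE.
Qed.

Lemma wedge_coboundE x y z :
  wedge_cobound x y z = mu y z (H x) - mu x z (H y) + [ly H x, H y, H z].
Proof. by rewrite linfunE_linear // => a z1 z2; rewrite !homP !homPl; combine. Qed.

Lemma cobound_wedge x y : cobound (wedge x y) = wedge_cobound x y.
Proof.
apply: ext2_lift_wedge => [v a u u'|u a v v'|u]; apply/lfunP => z.
- by rewrite homPl !wedge_coboundE !homP !homPl; combine.
- by rewrite homPl !wedge_coboundE !homP !homPl; combine.
- by rewrite wedge_coboundE ly_tr_alt zero_lfunE subrr addr0.
Qed.

Lemma B1_sub_Z1 : is_action rho mu -> is_crossed_hom H -> (B1 <= Z1)%VS.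
Proof.
move=> [[_ _ rep_rho rep_D rep_mu] rhoC muC rho_br mu_br rho_tr mu_tr] [Hbr Htr].
have rhoL a b x u : rho [ly a, b, x] u = D a b (rho x u) - rho x (D a b u).
  by rewrite rep_rho /gl_comm add_lfunE opp_lfunE !comp_lfunE.
have muL a b x y u : mu [ly a, b, x] y u
    = D a b (mu x y u) - mu x y (D a b u) - mu x [ly a, b, y] u.
  apply: (addIr (mu x [ly a, b, y] u)); rewrite subrK -[LHS]add_lfunE rep_mu.
  by rewrite /gl_comm add_lfunE opp_lfunE !comp_lfunE.
have DL a b x y u : D [ly a, b, x] y u
    = D a b (D x y u) - D x y (D a b u) - D x [ly a, b, y] u.
  rewrite (repDE [ly a, b, x]) !(repDE x y) (repDE x [ly a, b, y]) !muL !rhoL.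
  have -> : rho [ly [ly a, b, x], y] u = D a b (rho [ly x, y] u)
      - rho [ly x, y] (D a b u) - rho [ly x, [ly a, b, y]] u.
    by rewrite -rhoL ly_tr_br homD add_lfunE addrK.
  set E := D a b; rewrite !(homD E, homN E) (homD (rho y)) (homN (rho y)).
  by rewrite (homD (rho x)) (homN (rho x)); combine.
have trC (u : h) : in_center u ->
    [/\ forall v, [ly v, u] = 0, forall v w, [ly u, v, w] = 0,
        forall v w, [ly v, u, w] = 0 & forall v w, [ly v, w, u] = 0].
  move=> [u0 uC].
  have u1 v : [ly v, u] = 0 by rewrite ly_br_skew u0 oppr0.
  have u2 v w : [ly u, v, w] = 0.
    by case: uC => uC; rewrite // ly_tr_skew uC oppr0.
  have u3 v w : [ly v, u, w] = 0 by rewrite ly_tr_skew u2 oppr0.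
  split=> // v w; have := ly_jacobi v w u.
  by rewrite u0 u1 !u1 !hom0 !zero_lfunE u2 u3 !add0r !addr0.
have rhoC' x u := trC _ (rhoC x u).
have muC' x y u := trC _ (muC x y u).
have DC a b u :
    [/\ forall v, [ly v, D a b u] = 0, forall v w, [ly D a b u, v, w] = 0,
        forall v w, [ly v, D a b u, w] = 0 & forall v w, [ly v, w, D a b u] = 0].
  rewrite repDE; case: (muC' b a u) (muC' a b u) (rhoC' a (rho b u))
    (rhoC' b (rho a u)) (rhoC' [ly a, b] u)
    => [m1 m2 m3 m4] [n1 n2 n3 n4] [p1 p2 p3 p4] [q1 q2 q3 q4] [r1 r2 r3 r4].
  split=> [v|v w|v w|v w]; hom_expand.
  - by rewrite m1 n1 p1 q1 r1 !subr0 addr0.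
  - by rewrite m2 n2 p2 q2 r2 !subr0 addr0.
  - by rewrite m3 n3 p3 q3 r3 !subr0 addr0.
  - by rewrite m4 n4 p4 q4 r4 !subr0 addr0.
have Dbr a b u v : D a b [ly u, v] = 0.
  by rewrite repDE !mu_br !rho_br !hom0 !subr0 addr0.
have Dtr a b u v w : D a b [ly u, v, w] = 0.
  by rewrite repDE !mu_tr !rho_tr !hom0 !subr0 addr0.
have wE a b z : wedge_cobound a b z = H [ly a, b, z] - D a b (H z).
  by rewrite wedge_coboundE Htr; combine.
have Z1w a b : wedge_cobound a b \in Z1.
  apply/Z1P; split=> [x y|x y z].
  - rewrite /cobr /rhoH !wE ly_tr_br (homB (ly_br h (H x))) (homB (rho x)).
    rewrite (homB (ly_br h (H y))) (homB (rho y)) (homD H) !Hbr.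
    rewrite (homD (D a b)) (homB (D a b)) Dbr.
    case: (DC a b (H x)) (DC a b (H y)) => [x1 _ _ _] [y1 _ _ _].
    by rewrite x1 y1 !rhoL (ly_br_skew (H [ly a, b, x])); combine.
  - have trB (u v w w' : h) : [ly u - v, w, w'] = [ly u, w, w'] - [ly v, w, w'].
      by rewrite homB !add_lfunE !opp_lfunE.
    case: (DC a b (H x)) (DC a b (H y)) (DC a b (H z))
      => [_ x2 _ _] [_ y2 _ _] [_ _ _ z4].
    rewrite /cotr /DH /muH !wE !trB (homB (ly_tr h (H x) (H y))) x2 y2 z4.
    rewrite (homB (D x y)) (homB (mu y z)) (homB (mu x z)).
    rewrite ly_tr_tr !(homD H) (Htr [ly a, b, x] y z) (Htr x [ly a, b, y] z).
    rewrite (Htr x y [ly a, b, z]) (Htr x y z) DL !muL.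
    rewrite (homD (D a b)) (homB (D a b)) (homD (D a b)) Dtr.
    by rewrite (ly_tr_skew (H x) (H [ly a, b, y])); combine.
have cbr0 : (cobr_lfun \o cobound)%VF = 0.
  apply: ext2_eq => a b; rewrite comp_lfunE cobound_wedge zero_lfunE.
  by apply/eqP; rewrite -memv_ker; have := Z1w a b; rewrite memv_cap => /andP[].
have ctr0 : (cotr_lfun \o cobound)%VF = 0.
  apply: ext2_eq => a b; rewrite comp_lfunE cobound_wedge zero_lfunE.
  by apply/eqP; rewrite -memv_ker; have := Z1w a b; rewrite memv_cap => /andP[].
apply/subvP => _ /memv_imgP[X _ ->]; rewrite memv_cap !memv_ker -!comp_lfunE.
by rewrite cbr0 ctr0 !zero_lfunE !eqxx.
Qed.

Lemma cohom_classP (f1 f2 : subvs_of Z1) :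
  cohom_class f1 = cohom_class f2 <-> vsval f1 - vsval f2 \in B1.
Proof.
rewrite /cohom_class; split.
  move/eqP; rewrite -Quotient.idealrBE -memv_preim.
  by rewrite linfunE_linear //; exact: linearP.
move=> fB; apply/eqP; rewrite -Quotient.idealrBE -memv_preim.
by rewrite linfunE_linear //; exact: linearP.
Qed.

End Cohomology.

(* Formal power series with coefficients in U are sequences nat -> U; the
   following are the K[[t]]-bilinear and -trilinear extensions (Cauchy
   products) of B and T, and the action of a series of linear maps. *)
Definition ps2 (U V W : vectType K) (B : 'Hom(U, 'Hom(V, W)))
    (a : nat -> U) (b : nat -> V) (n : nat) : W :=
  \sum_(i < n.+1) B (a i) (b (n - i)%N).

Definition ps3 (U V W X : vectType K) (T : 'Hom(U, 'Hom(V, 'Hom(W, X))))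
    (a : nat -> U) (b : nat -> V) (c : nat -> W) (n : nat) : X :=
  \sum_(i < n.+1) \sum_(j < (n - i).+1) T (a i) (b j) (c (n - i - j)%N).

Definition ps_app (U V : vectType K) (F : nat -> 'Hom(U, V))
    (a : nat -> U) (n : nat) : V :=
  \sum_(i < n.+1) F i (a (n - i)%N).

(* The value of the series F at a constant vector x. *)
Definition ps_at (U V : vectType K) (F : nat -> 'Hom(U, V)) (x : U)
    (n : nat) : V := F n x.

Record is_formal_deformation (H : 'Hom(g, h)) (Ht : nat -> 'Hom(g, h))
    : Prop := {
  fdef_0 : Ht 0%N = H;
  fdef_br : forall (x y : g) n,
    Ht n [ly x, y] = rho x (ps_at Ht y n) - rho y (ps_at Ht x n)
                    + ps2 (ly_br h) (ps_at Ht x) (ps_at Ht y) n;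
  fdef_tr : forall (x y z : g) n,
    Ht n [ly x, y, z] = D x y (ps_at Ht z n) + mu y z (ps_at Ht x n)
                       - mu x z (ps_at Ht y n)
                       + ps3 (ly_tr h) (ps_at Ht x) (ps_at Ht y) (ps_at Ht z) n
}.

Definition ps_ly_morphism (k : lieYamaguti K) (phi : nat -> 'End(k)) : Prop :=
  (forall x y n,
     ps2 (ly_br k) (ps_at phi x) (ps_at phi y) n = ps_at phi [ly x, y] n) /\
  (forall x y z n,
     ps3 (ly_tr k) (ps_at phi x) (ps_at phi y) (ps_at phi z) n
     = ps_at phi [ly x, y, z] n).

(* phi and vphi are Id + t L(X) + O(t^2) and Id + t D(X) + O(t^2); the last
   clause is the equality of K[[t]]-module maps Ht o phi = vphi o Hb. *)
Definition equivalent_deformations (Hb Ht : nat -> 'Hom(g, h)) : Prop :=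
  exists (X : ext2 g) (phi : nat -> 'End(g)) (vphi : nat -> 'End(h)),
    [/\ [/\ phi 0%N = \1%VF, phi 1%N = extL X,
            vphi 0%N = \1%VF & vphi 1%N = extD X],
        ps_ly_morphism phi,
        ps_ly_morphism vphi,
        (forall x u n,
           ps_at vphi (rho x u) n = ps2 rho (ps_at phi x) (ps_at vphi u) n) /\
        (forall x y u n,
           ps_at vphi (mu x y u) n
           = ps3 mu (ps_at phi x) (ps_at phi y) (ps_at vphi u) n)
      & forall (a : nat -> g) n,
          ps_app Ht (ps_app phi a) n = ps_app vphi (ps_app Hb a) n].

End CrossedHomomorphism.

(* Main.v *)
Require Import Defs.
From HB Require Import structures.
From mathcomp Require Import all_boot all_order all_algebra ring.

Set Implicit Arguments.
Unset Strict Implicit.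
Unset Printing Implicit Defensive.

Import GRing.Theory.
Local Open Scope ring_scope.

(** Everything happens in the coefficient of [t].  Differentiating the two
    equations of a formal deformation at [t = 0] gives exactly the two cocycle
    equations, so both infinitesimals are cocycles ([infinitesimal_cocycle]).
    The coefficient of [t] in [Ht o phi = vphi o Hb], evaluated at a constant
    vector [z], reads [Ht_1 z + H (L(X) z) = Hb_1 z + D(X) (H z)], that is,
    [Hb_1 - Ht_1 = H o L(X) - D(X) o H].

    The right-hand side is the coboundary of [X] ([coboundE]): on a wedge
    [x /\ y] this is the ternary equation of the crossed homomorphism with
    [D(x, y) (H z)] moved to the other side, and both sides are linear in [X]. *)

Lemma ps2_coef1 (K : fieldType) (U V W : vectType K)
    (B : 'Hom(U, 'Hom(V, W))) (a : nat -> U) (b : nat -> V) :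
  ps2 B a b 1 = B (a 0%N) (b 1%N) + B (a 1%N) (b 0%N).
Proof. by rewrite /ps2 !big_ord_recl big_ord0 addr0. Qed.

Lemma ps3_coef1 (K : fieldType) (U V W X : vectType K)
    (T : 'Hom(U, 'Hom(V, 'Hom(W, X)))) (a : nat -> U) (b : nat -> V)
    (c : nat -> W) :
  ps3 T a b c 1 = T (a 0%N) (b 0%N) (c 1%N) + T (a 0%N) (b 1%N) (c 0%N)
                  + T (a 1%N) (b 0%N) (c 0%N).
Proof. by rewrite /ps3 !big_ord_recl !big_ord0 !addr0. Qed.

Lemma ps_app_coef0 (K : fieldType) (U V : vectType K) (F : nat -> 'Hom(U, V))
    (a : nat -> U) : ps_app F a 0 = F 0%N (a 0%N).
Proof. by rewrite /ps_app big_ord_recl big_ord0 addr0. Qed.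

Lemma ps_app_coef1 (K : fieldType) (U V : vectType K) (F : nat -> 'Hom(U, V))
    (a : nat -> U) : ps_app F a 1 = F 0%N (a 1%N) + F 1%N (a 0%N).
Proof. by rewrite /ps_app !big_ord_recl big_ord0 addr0. Qed.

Section Infinitesimals.
Variables (K : fieldType) (g h : lieYamaguti K).
Variables (rho : 'Hom(g, 'End(h))) (mu : 'Hom(g, 'Hom(g, 'End(h)))).
Variable H : 'Hom(g, h).

(** The cocycle equations are the linearisation at [H] of the equations of a
    crossed homomorphism; skew-symmetry of the brackets of [h] brings the
    differentiated argument to the place it has in [rhoH] and [muH]. *)
Lemma infinitesimal_cocycle (Ht : nat -> 'Hom(g, h)) :
  is_formal_deformation rho mu H Ht -> Ht 1%N \in Z1 rho mu H.
Proof.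
move=> [H0 Hbr Htr]; apply/Z1P; split=> [x y|x y z].
- rewrite /cobr /rhoH Hbr ps2_coef1 /ps_at H0.
  by rewrite (ly_br_skew (Ht 1%N x)); combine.
- rewrite /cotr /DH /muH Htr ps3_coef1 /ps_at H0.
  by rewrite (ly_tr_skew (H x) (Ht 1%N y)); combine.
Qed.

(** The coboundary of [X] measures how far [H] is from intertwining the
    inner derivation [L(X)] of [g] with [D(X)]. *)
Lemma coboundE (X : ext2 g) (z : g) :
  is_crossed_hom rho mu H ->
  cobound mu H X z = H (extL g X z) - extD rho mu X (H z).
Proof.
move=> [_ Htr].
pose G (Y : ext2 g) : 'Hom(g, h) := (H \o extL g Y)%VF - (extD rho mu Y \o H)%VF.
have GE Y w : G Y w = H (extL g Y w) - extD rho mu Y (H w).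
  by rewrite /G add_lfunE opp_lfunE !comp_lfunE.
have Glin : linear G.
  move=> a Y Y'; apply/lfunP => w.
  by rewrite homPl !GE !homP !homPl !homP; combine.
have -> : cobound mu H = linfun G.
  apply: ext2_eq => x y; apply/lfunP => w.
  rewrite cobound_wedge wedge_coboundE linfunE_linear // GE.
  by rewrite extL_wedge extD_wedge Htr; combine.
by rewrite linfunE_linear // GE.
Qed.

Lemma equivalent_infinitesimals (Hb Ht : nat -> 'Hom(g, h)) :
  is_crossed_hom rho mu H -> Hb 0%N = H -> Ht 0%N = H ->
  equivalent_deformations rho mu Hb Ht ->
  Hb 1%N - Ht 1%N \in B1 mu H.
Proof.
move=> crH Hb0 Ht0 [X [phi [vphi [[phi0 phi1 vphi0 vphi1] _ _ _ appE]]]].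
suff -> : Hb 1%N - Ht 1%N = cobound mu H X by rewrite memv_img ?memvf.
apply/lfunP => z; rewrite add_lfunE opp_lfunE coboundE //.
(* The equivalence is tested on z, seen as a constant power series. *)
have := appE (fun n => if n is 0%N then z else 0) 1%N.
rewrite !(ps_app_coef1, ps_app_coef0) phi0 phi1 vphi0 vphi1 Hb0 Ht0.
rewrite !hom0 !add0r !id_lfunE => E.
by apply/eqP; rewrite subr_eq addrAC -subr_eq opprK E.
Qed.

End Infinitesimals.

Theorem theorem5p11 (K : fieldType) (charK : [pchar K] =i pred0)
    (g h : lieYamaguti K)
    (rho : 'Hom(g, 'End(h))) (mu : 'Hom(g, 'Hom(g, 'End(h))))
    (act : is_action rho mu)
    (H : 'Hom(g, h)) (crossed : is_crossed_hom rho mu H)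
    (Hb Ht : nat -> 'Hom(g, h))
    (defHb : is_formal_deformation rho mu H Hb)
    (defHt : is_formal_deformation rho mu H Ht)
    (equiv : equivalent_deformations rho mu Hb Ht) :
  exists (cHb : Hb 1%N \in Z1 rho mu H) (cHt : Ht 1%N \in Z1 rho mu H),
    cohom_class (Subvs cHb) = cohom_class (Subvs cHt).
Proof.
exists (infinitesimal_cocycle defHb), (infinitesimal_cocycle defHt).
apply/cohom_classP; apply: (equivalent_infinitesimals crossed _ _ equiv).
- exact: fdef_0 defHb.
- exact: fdef_0 defHt.
Qed.
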